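(* Let $S\neq\mathbb{N}$ be a non-ordinary numerical semigroup, and let $T(S)=\{x\in\mathbb{N}\mid F(S)-x\in(\mathbb{Z}\setminus S)\cup\{0\}\}$ be its $T$-Set (a numerical set). Then $$t(S\cup\{F(S)\})=t(S)+t(T(S))-1\geq t(S).$$
   Context: $\mathbb{N}=\{0,1,2,\dots\}$. A numerical set is a subset $H\subseteq\mathbb{N}$ containing $0$ with finite complement in $\mathbb{N}$; a numerical semigroup is a numerical set closed under addition. Elements of $\mathbb{N}\setminus H$ are the gaps of $H$; for $H\neq\mathbb{N}$ the Frobenius number $F(H)$ is the largest gap; the multiplicity $m(H)$ is the smallest nonzero element. $H\neq\mathbb{N}$ is ordinary if $m(H)=F(H)+1$, i.e. $H=\{0\}\cup\{x\in\mathbb{N}\mid x\geq F(H)+1\}$, and non-ordinary otherwise. For a numerical set $H$, $PF(H)=\{a\in\mathbb{N}\mid a\notin H,\ a+(H\setminus\{0\})\subseteq H\}$ and the type of $H$ is $t(H)=|PF(H)|$. *)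

(* Defs.v *)
From mathcomp Require Import all_boot all_order all_algebra.
From mathcomp Require Import finmap.
From mathcomp Require Import mathcomp_extra boolp classical_sets functions cardinality.

Set Implicit Arguments.
Unset Strict Implicit.
Unset Printing Implicit Defensive.

Import Order.TTheory GRing.Theory Num.Theory.
Local Open Scope classical_set_scope.

Definition numerical_set (H : set nat) : Prop :=
  H 0 /\ finite_set (~` H).

Definition numerical_semigroup (H : set nat) : Prop :=
  numerical_set H /\ (forall x y : nat, H x -> H y -> H (x + y)).

Definition gaps (H : set nat) : set nat := ~` H.

(* The largest gap; the default value 0 is taken when there is none, in
   particular for H = setT, where the Frobenius number is not defined. *)
Definition frobenius (H : set nat) : nat :=
  xget 0 (gaps H `&` ubound (gaps H)).

(* The least nonzero element; it exists as soon as the complement is finite. *)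
Definition multiplicity (H : set nat) : nat :=
  xget 0 ((H `\ 0) `&` lbound (H `\ 0)).

Definition ordinary (H : set nat) : Prop :=
  H <> setT /\ multiplicity H = frobenius H + 1.

Definition PF (H : set nat) : set nat :=
  [set a | ~ H a /\ [set a + h | h in H `\ 0] `<=` H].

(* PF H is a set of gaps, hence finite when H is a numerical set (see
   [finite_PF]); [fset_set] sends infinite sets to the empty one. *)
Definition nstype (H : set nat) : nat := #|` fset_set (PF H)|.

(* The difference and the complement are taken in int. *)
Definition Tset (S : set nat) : set nat :=
  [set x : nat |
    (~` [set s%:Z%R | s in S] `|` [set 0%R]) ((frobenius S)%:Z - x%:Z)%R].

Lemma frobenius_max (H : set nat) : numerical_set H -> H <> setT ->
  gaps H (frobenius H) /\ (forall g, gaps H g -> g <= frobenius H).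
Proof.
move=> [_ finH] HT; rewrite /frobenius.
have [g0 g0H] : exists g, gaps H g.
  apply: contrapT => noG; apply: HT; rewrite -subTset => x _.
  by apply: contrapT => Hx; apply: noG; exists x.
have exg : exists g, `[< gaps H g >] by exists g0; apply/asboolP.
have ubg g : `[< gaps H g >] -> g <= \max_(i <- fset_set (gaps H)) i.
  move=> /asboolP gH; apply: (@leq_bigmax_seq _ _ xpredT id) => //.
  by rewrite in_fset_set// inE.
case: (ex_maxnP exg ubg) => m /asboolP mH mmax.
have [] : (gaps H `&` ubound (gaps H))
    (xget 0 (gaps H `&` ubound (gaps H))).
  by apply: xgetPex; exists m; split=> // x /asboolP /mmax; rewrite leEnat.
by move=> ? ub; split=> // g /ub; rewrite leEnat.
Qed.

Lemma numerical_set_ge (H : set nat) : finite_set (~` H) ->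
  exists n, forall x, n <= x -> H x.
Proof.
move=> finH; exists (\max_(i <- fset_set (~` H)) i).+1 => x nx.
apply: contrapT => Hx; move: nx; rewrite ltnNge => /negP; apply.
by apply: (@leq_bigmax_seq _ _ xpredT id) => //; rewrite in_fset_set// inE.
Qed.

Lemma multiplicity_min (H : set nat) : numerical_set H ->
  (H `\ 0) (multiplicity H) /\
  (forall h, (H `\ 0) h -> multiplicity H <= h).
Proof.
move=> [_ /numerical_set_ge [n nH]]; rewrite /multiplicity.
have exh : exists h, `[< (H `\ 0) h >].
  by exists n.+1; apply/asboolP; split=> //; apply: nH.
case: (ex_minnP exh) => m /asboolP mH mmin.
have [] : ((H `\ 0) `&` lbound (H `\ 0))
    (xget 0 ((H `\ 0) `&` lbound (H `\ 0))).
  by apply: xgetPex; exists m; split=> // x /asboolP /mmin; rewrite leEnat.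
by move=> ? lb; split=> // h /lb; rewrite leEnat.
Qed.

Lemma finite_PF (H : set nat) : numerical_set H -> finite_set (PF H).
Proof. by move=> [_]; apply: sub_finite_set => a []. Qed.

Lemma numerical_set_addF (S : set nat) : numerical_set S ->
  numerical_set (S `|` [set frobenius S]).
Proof.
move=> [S0 finS]; split; first by left.
by apply: sub_finite_set finS => x; rewrite setCU => -[].
Qed.

Lemma numerical_set_Tset (S : set nat) : numerical_set S -> S <> setT ->
  numerical_set (Tset S).
Proof.
move=> nS ST; have [FS _] := frobenius_max nS ST; split.
  by left; rewrite /= subr0 => -[s Ss [sF]]; apply: FS; rewrite -sF.
apply: (@sub_finite_set _ _ `I_(frobenius S).+1); last exact: finite_II.
move=> x /= Tx; rewrite ltnS leqNgt; apply/negP => Fx; apply: Tx.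
left=> -[s _ /eqP]; rewrite eq_sym subr_eq => /eqP [Fsx].
by move: Fx; rewrite Fsx ltnNge leq_addl.
Qed.

(* Main.v *)
(* Put F = F(S) and S' = S `|` {F}. The gaps of T(S) are the F - s with
   s in S, 0 < s < F, and both PF(T(S)) and PF(S') are cut out by the same
   condition a + (S \ {0}) `<=` S': among the gaps of T(S) for PF(T(S)), among
   the gaps of S' for PF(S'). An a in PF(S') is not in PF(S) exactly when
   a + s = F for some nonzero s in S, i.e. when a is a gap of T(S). Hence
   PF(S') and {F} on one side, PF(S) and PF(T(S)) on the other, are two
   partitions of the same set. Non-ordinarity gives m(S) < F, and then
   F - m(S) is in PF(T(S)). *)
Require Import Defs.
From mathcomp Require Import all_boot all_order all_algebra.
From mathcomp Require Import finmap.
From mathcomp Require Import mathcomp_extra boolp classical_sets functions cardinality.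
From mathcomp Require Import zify.
Local Open Scope classical_set_scope.

(** The witness [s] is the integer [F - x]; for [x > F] it is negative, so [x] lies in [Tset S]. *)
Lemma gap_TsetP (S : set nat) (x : nat) :
  ~ Tset S x <-> exists s, (S `\ 0) s /\ x + s = frobenius S.
Proof.
split=> [/not_orP[/contrapT[s Ss sE] x0]|[s [[Ss s0] xs]]].
  by exists s; split; [split=> //= s0; apply: x0 => /=; lia | lia].
case; first by apply; exists s => //; lia.
by rewrite /=; move: s0 => /= s0; lia.
Qed.

Lemma gt_frobenius (S : set nat) (x : nat) : numerical_set S -> S <> setT ->
  frobenius S < x -> S x.
Proof.
move=> nS ST; have [_ Fmax] := frobenius_max nS ST.
by move=> Fx; apply: contrapT => /Fmax; rewrite leqNgt Fx.
Qed.

Lemma frobenius_PF (S : set nat) : numerical_set S -> S <> setT ->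
  PF S (frobenius S).
Proof.
move=> nS ST; split; first by have [] := frobenius_max nS ST.
by move=> _ [h [_ /= h0] <-]; apply: gt_frobenius => //; lia.
Qed.

(** Since [F + 1] is in [S], m(S) is at most [F + 1]; equality would make [S] ordinary, and m(S)
    cannot be the gap [F]. *)
Lemma multiplicity_lt_frobenius (S : set nat) : numerical_set S ->
  S <> setT -> ~ ordinary S -> multiplicity S < frobenius S.
Proof.
move=> nS ST nord; have [[Sm _] mmin] := multiplicity_min nS.
have [nSF _] := frobenius_max nS ST.
have mF : multiplicity S <> frobenius S by move=> mF; apply: nSF; rewrite -mF.
have mF1 : multiplicity S <= frobenius S + 1.
  by apply: mmin; split; [apply: gt_frobenius => //; lia | rewrite /=; lia].
have : multiplicity S <> frobenius S + 1 by move=> ?; apply: nord.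
by lia.
Qed.

(** The new element [F] imposes no condition: [a] is nonzero because 0 is in [S], so [a + F > F]. *)
Lemma PF_addFP (S : set nat) (a : nat) : numerical_set S -> S <> setT ->
  PF (S `|` [set frobenius S]) a <->
  [/\ ~ S a, a <> frobenius S &
      forall h, (S `\ 0) h -> (S `|` [set frobenius S]) (a + h)].
Proof.
move=> nS ST; split=> [[/not_orP[nSa aF] aS]|[nSa aF aS]].
  by split=> // h [Sh h0]; apply: aS; exists h => //; split=> //; left.
split; first by case.
move=> _ [h [[Sh|->] h0] <-]; first by apply: aS.
left; apply: gt_frobenius => //; suff : a <> 0 by lia.
by move=> a0; apply: nSa; rewrite a0; case: nS.
Qed.

(* Write a + s = F. For 0 < h < s, the condition on h is the contrapositive
   of the condition on t = s - h in the definition of PF(T(S)): a + t is a gap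
   of T(S) iff h is in S, and t is a gap of T(S) iff a + h is in S. *)
Lemma PF_TsetP (S : set nat) (a : nat) : numerical_set S -> S <> setT ->
  PF (Tset S) a <->
  ~ Tset S a /\ forall h, (S `\ 0) h -> (S `|` [set frobenius S]) (a + h).
Proof.
move=> nS ST; split=> [[nTa aT]|[nTa aS]]; split=> //;
  have [s [[Ss s0] asF]] := (gap_TsetP S a).1 nTa.
  move=> h [Sh h0]; have [hs|sh|->] := ltngtP h s; last by right.
    apply: contrapT => /not_orP[nSah _].
    suff : Tset S (a + (s - h)).
      by apply/gap_TsetP; exists h; split=> //; lia.
    apply: aT; exists (s - h) => //; split; last by rewrite /=; lia.
    apply: contrapT => /gap_TsetP [u [[Su _] uF]]; apply: nSah.
    by rewrite (_ : a + h = u) //; lia.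
  by left; apply: gt_frobenius => //; lia.
move=> _ [t [Tt t0] <-]; apply: contrapT => /gap_TsetP[u [[Su u0] uF]].
(* Here [a + t + u = F], so [a + u = F] would force [t = 0]. *)
move: t0 u0 => /= t0 u0; have [//|Sau|/= auF] := aS u; last by lia.
suff : ~ Tset S t by [].
apply/gap_TsetP; exists (a + u); split; last by lia.
by split=> //= au0; apply: u0; lia.
Qed.

Lemma PF_addF_partition (S : set nat) : numerical_semigroup S ->
  S <> setT ->
  PF (S `|` [set frobenius S]) `|` [set frobenius S] = PF S `|` PF (Tset S).
Proof.
move=> [nS addS] ST; have [nSF _] := frobenius_max nS ST.
apply/seteqP; split=> a.
  case=> [/(PF_addFP _ _ nS ST)[nSa aF aS]|->].
    have [Ta|nTa] := pselect (Tset S a); last by right; apply/PF_TsetP.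
    left; split=> // _ [h hS <-]; have [//|/= ahF] := aS _ hS.
    by suff : ~ Tset S a by []; apply/gap_TsetP; exists h.
  by left; apply: frobenius_PF.
have [-> _|aF] := eqVneq a (frobenius S); first by right.
case=> [[nSa aS]|/(PF_TsetP _ _ nS ST)[nTa aS]]; left; apply/PF_addFP => //.
  by split=> //; [apply/eqP | move=> h hS; left; apply: aS; exists h].
split=> //; last exact/eqP.
have [s [[Ss _] asF]] := (gap_TsetP S a).1 nTa.
(* Closure under addition: if [a] were in [S], so would be [a + s = F]. *)
by move=> Sa; apply: nSF; rewrite -asF; apply: addS.
Qed.

Lemma disjoint_PF_Tset (S : set nat) : numerical_set S -> S <> setT ->
  PF S `&` PF (Tset S) = set0.
Proof.
move=> nS ST; have [nSF _] := frobenius_max nS ST.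
rewrite -subset0 => a [[_ aS] [/gap_TsetP[s [sS asF]] _]].
by apply: nSF; rewrite -asF; apply: aS; exists s.
Qed.

Lemma card_fset_set_setU (T : choiceType) (A B : set T) : finite_set A ->
  finite_set B -> A `&` B = set0 ->
  #|` fset_set (A `|` B)| = #|` fset_set A| + #|` fset_set B|.
Proof.
move=> finA finB AB0.
by rewrite fset_setU// -cardfsUI -fset_setI// AB0 fset_set0 cardfs0 addn0.
Qed.

Lemma nstype_addF (S : set nat) : numerical_semigroup S -> S <> setT ->
  nstype (S `|` [set frobenius S]) + 1 = nstype S + nstype (Tset S).
Proof.
move=> semiS ST; have [nS _] := semiS.
rewrite /nstype -(cardfs1 (frobenius S)) -fset_set1.
(* Both sides become the cardinality of the same union; finiteness and disjointness remain. *)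
rewrite -!card_fset_set_setU ?PF_addF_partition ?disjoint_PF_Tset//.
- by apply: finite_PF.
- by apply/finite_PF/numerical_set_Tset.
- by apply/finite_PF/numerical_set_addF.
- by rewrite -subset0 => a [/PF_addFP[]].
Qed.

(** By minimality of m(S), adding a nonzero [h] of [S] to [F - m(S)] gives [F] if [h] is m(S), and
    more than [F] otherwise. *)
Lemma PF_Tset_multiplicity (S : set nat) : numerical_set S -> S <> setT ->
  ~ ordinary S -> PF (Tset S) (frobenius S - multiplicity S).
Proof.
move=> nS ST nord; have mF := multiplicity_lt_frobenius _ nS ST nord.
have [mS mmin] := multiplicity_min nS.
apply/PF_TsetP => //; split.
  by apply/gap_TsetP; exists (multiplicity S); split=> //; lia.
move=> h /mmin; rewrite leq_eqVlt => /predU1P[<-|mh].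
  by right; rewrite /=; lia.
by left; apply: gt_frobenius => //; lia.
Qed.

Lemma nstype_gt0 (H : set nat) (a : nat) : numerical_set H -> PF H a ->
  0 < nstype H.
Proof.
move=> nH aPF; rewrite /nstype cardfs_gt0; apply/fset0Pn; exists a.
by rewrite in_fset_set ?inE//; apply: finite_PF.
Qed.

Local Open Scope ring_scope.

Theorem corollary4p8p1 (S : set nat) (semiS : numerical_semigroup S)
    (properS : S <> setT) (nonordS : ~ ordinary S) :
  (nstype (S `|` [set frobenius S]))%:Z
    = (nstype S)%:Z + (nstype (Tset S))%:Z - 1
  /\ (nstype S)%:Z + (nstype (Tset S))%:Z - 1 >= (nstype S)%:Z.
Proof.
have [nS _] := semiS.
have typeE := nstype_addF _ semiS properS.
have type_gt0 := nstype_gt0 _ _ (numerical_set_Tset nS properS)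
  (PF_Tset_multiplicity _ nS properS nonordS).
by split; lia.
Qed.
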